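(* Let $\mathfrak x=\langle A,B,E\rangle$ be a cardinal characteristic of the continuum. Suppose that $\kappa:=\mathfrak x=|B|$ (i.e. $\mathfrak x$ is as large as possible), and let $\mathscr F$ be any family of finitary operations on $B$ with $|\mathscr F|<\kappa$. Then there is an $\langle\mathfrak x,\mathscr F,\kappa\rangle$-pathway.
   Context: A cardinal characteristic of the continuum is given by a triple $\langle A,B,E\rangle$, where $|A|,|B|\le\mathfrak c$ (with $\mathfrak c=2^{\aleph_0}$) and $E\subseteq A\times B$, and where, so that the following cardinal is well defined, $(\forall a\in A)(\exists b\in B)(a\,E\,b)$; its value is $$\mathfrak x=\min\{|X| : X\subseteq B\wedge(\forall a\in A)(\exists b\in X)(a\,E\,b)\}.$$ The triple and its value are denoted by the same letter. A finitary operation on $B$ is a function $F:B^n\to B$ for some $n<\omega$. Let $\mathscr F$ be a collection of finitary operations on $B$ and let $\kappa$ be a regular cardinal. An $\langle\mathfrak x,\mathscr F,\kappa\rangle$-pathway is a sequence $\langle B_\alpha : \alpha<\kappa\rangle$ of subsets of $B$ that is increasing ($B_\alpha\subseteq B_\beta$ for $\alpha\le\beta$) and continuous ($B_\alpha=\bigcup_{\xi<\alpha}B_\xi$ for limit $\alpha$), such that: (1) $\bigcup_{\alpha<\kappa}B_\alpha=B$; (2) for every $\alpha<\kappa$ there is $x\in A$ such that $\neg(x\,E\,y)$ for all $y\in B_\alpha$; (3) each $B_\alpha$ is closed under $\mathscr F$, that is, $F[B_\alpha^n]\subseteq B_\alpha$ for each $n$-ary $F\in\mathscr F$.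
   Formalization: The formal theorem additionally assumes that κ is uncountable; without this the claim fails, e.g. for A = B = ω, E = ≤ and 𝓕 = {successor}, where every nonempty set closed under 𝓕 is dominating. *)

(* Defs.v *)
From mathcomp Require Import all_boot all_order.
From mathcomp Require Import boolp classical_sets functions cardinality wochoice.

Set Implicit Arguments.
Unset Strict Implicit.
Unset Printing Implicit Defensive.

Local Open Scope classical_set_scope.
Local Open Scope card_scope.
Local Open Scope order_scope.

Definition card_lt T U (S : set T) (V : set U) : Prop :=
  (S #<= V) /\ ~ (V #<= S).

(* The continuum is the cardinality of [set nat]. *)
Record cardchar := CardChar {
  challenges : Type;
  responses : Type;
  answers : challenges -> responses -> Prop;
  challenges_le_continuum : [set: challenges] #<= [set: set nat];
  responses_le_continuum : [set: responses] #<= [set: set nat];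
  answers_total : forall a, exists b, answers a b }.

Definition dominating (x : cardchar) (X : set (responses x)) : Prop :=
  forall a, exists2 b, X b & answers a b.

(* The value of [x], min {|X| : X dominating}, is the cardinality of [V]. *)
Definition value_is (x : cardchar) T (V : set T) : Prop :=
  (exists2 X : set (responses x), dominating X & X #= V) /\
  (forall X : set (responses x), dominating X -> V #<= X).

(* A cardinal, i.e. an initial ordinal, is represented by a well-ordered type
   each of whose proper initial segments has strictly smaller cardinality;
   its elements are the ordinals below the cardinal. *)
Definition is_cardinal d (K : orderType d) : Prop :=
  well_order (<=%O : rel K) /\
  forall alpha : K, card_lt [set xi : K | xi < alpha] [set: K].

(* 0 is not a limit. *)
Definition is_limit d (K : orderType d) (alpha : K) : Prop :=
  (exists xi : K, xi < alpha) /\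
  (forall xi : K, xi < alpha -> exists2 eta : K, xi < eta & eta < alpha).

Definition finitary_op (B : Type) : Type := {n : nat & n.-tuple B -> B}.

Definition closed_under (B : Type) (F : set (finitary_op B)) (S : set B) : Prop :=
  forall f : finitary_op B, F f ->
  forall t : (projT1 f).-tuple B, (forall i, S (tnth t i)) -> S (projT2 f t).

(* The length K is any cardinal; none of the clauses involves its regularity. *)
Record is_pathway (x : cardchar) (F : set (finitary_op (responses x)))
    d (K : orderType d) (P : K -> set (responses x)) : Prop := IsPathway {
  pathway_increasing : forall alpha beta : K, alpha <= beta -> P alpha `<=` P beta;
  pathway_continuous : forall alpha : K, is_limit alpha ->
    P alpha = \bigcup_(xi in [set xi : K | xi < alpha]) P xi;
  pathway_exhausts : \bigcup_alpha P alpha = [set: responses x];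
  pathway_unanswered : forall alpha : K,
    exists a : challenges x, forall y, P alpha y -> ~ answers a y;
  pathway_closed : forall alpha : K, closed_under F (P alpha) }.

(* Main.v *)
Require Import Defs.
From mathcomp Require Import all_boot all_order.
From mathcomp Require Import boolp classical_sets functions cardinality wochoice.

Local Open Scope classical_set_scope.
Local Open Scope card_scope.

Import Order.TTheory.

(** Since [B] has cardinality [kappa], an injection [f : B -> kappa] ranks its
    elements, and [S alpha], the set of the [y] with [f y < alpha], has
    cardinality less than [kappa].  Let [P alpha] be the closure of [S alpha]
    under [F].  The sequence [P] increases because [S] does, it exhausts [B]
    because [kappa] has no greatest element ([cardinal_no_max]), and it is
    continuous because a directed union of sets closed under finitary
    operations is closed ([closed_under_bigcup]).

    What remains is that no [P alpha] answers every challenge.  As the value of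
    the characteristic is [kappa], a dominating set has at least [kappa]
    elements, so it suffices that closing a small set under few operations
    yields a small set.  Every element of the closure of [S] is the value of a
    term, hence of a word over the alphabet [S + F] read in reverse Polish
    notation ([card_op_closure_le]).  If [S] and [F] are both smaller than the
    uncountable [kappa], so is the set of these words ([card_lt_words]): the
    largest of [S], [F] and the natural numbers is an infinite set, and the
    words over an infinite set [T] inject into [T] ([card_seq_le]).

    This last fact, like the comparability of cardinals ([card_le_total]), is a
    consequence of the axiom of choice, obtained by applying Zorn's lemma to
    graphs of partial injections ordered by inclusion.  A maximal graph codes
    the words over some [X] inside [T] by elements of [X].  If the complement of
    [X] were at least as large as [X], it would contain a copy of [X] and the
    coding could be extended ([coding_extend]); so the complement injects into
    [X], and then the words over [T] can be coded by words over [X]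
    ([words_double]). *)

(** * Comparing cardinalities *)

Lemma set_inj_card_le {T U} {A : set T} {B : set U} {f : T -> U} :
  set_fun A B f -> set_inj A f -> A #<= B.
Proof.
move=> fAB /inj_card_eq /card_eqPle[_ Af].
by apply: card_le_trans Af _; apply: subset_card_le => _ [x /fAB Bfx <-].
Qed.

Lemma card_le_set_inj {T U} {A : set T} {B : set U} (u0 : U) :
  A #<= B -> exists2 f : T -> U, set_fun A B f & set_inj A f.
Proof.
elim/Ppointed: U => U in B u0 *; first by case: (no u0).
by move=> /pcard_leP[f]; exists f; [exact: funS|exact: inj].
Qed.

Lemma chain_bigcup_inj {T U} {C : set (set T)} {p : T -> U} :
  total_on C subset -> (forall G, C G -> set_inj G p) ->
  set_inj (\bigcup_(G in C) G) p.
Proof.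
move=> Ctot Cinj x y; rewrite !inE => -[G CG Gx] [H CH Hy].
have [GH|HG] := Ctot _ _ CG CH.
  by apply: (Cinj H CH); rewrite inE //; exact: GH.
by apply: (Cinj G CG); rewrite inE //; exact: HG.
Qed.

(** A maximal graph of a partial injection from [A] to [B] must exhaust [A] or
    [B], and it has the same cardinality as both of its projections. *)
Lemma card_le_total {T U} (A : set T) (B : set U) : A #<= B \/ B #<= A.
Proof.
pose matching (G : set (T * U)) :=
  [/\ G `<=` A `*` B, set_inj G fst & set_inj G snd].
have [|G [[GAB G1 G2] Gmax]] := @Zorn_bigcup _ matching.
  move=> C Cm Ctot; split.
  - by move=> p [G CG]; have [GAB _ _] := Cm G CG; exact: GAB.
  - by apply: (chain_bigcup_inj Ctot) => G /Cm[].
  - by apply: (chain_bigcup_inj Ctot) => G /Cm[].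
have /card_eqPle[le1G leG1] := inj_card_eq G1.
have /card_eqPle[le2G leG2] := inj_card_eq G2.
have [A1|/existsNP[a /not_implyP[Aa aG]]] := pselect (A `<=` fst @` G).
  left; apply: card_le_trans (subset_card_le A1) _.
  apply: card_le_trans le1G _; apply: card_le_trans leG2 _.
  by apply: subset_card_le => _ [p /GAB[_ Bp] <-].
right; have [B2|/existsNP[b /not_implyP[Bb bG]]] := pselect (B `<=` snd @` G).
  apply: card_le_trans (subset_card_le B2) _.
  apply: card_le_trans le2G _; apply: card_le_trans leG1 _.
  by apply: subset_card_le => _ [p /GAB[Ap _] <-].
exfalso; apply: (Gmax ((a, b) |` G)).
  split=> [p Gp|/(_ (a, b) (or_introl erefl)) Gab]; first by right.
  by apply: aG; exists (a, b).
split=> [p [->|/GAB]//|p q|p q]; rewrite !inE => -[->|Gp] [->|Gq] //= pq.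
- by case: aG; exists q.
- by case: aG; exists p.
- by apply: G1; rewrite ?inE.
- by case: bG; exists q.
- by case: bG; exists p.
- by apply: G2; rewrite ?inE.
Qed.

(** * Words over an infinite set *)

Definition words {T} (X : set T) : set (seq T) := [set w | all (mem X) w].

Lemma words_subset {T} {X Y : set T} : X `<=` Y -> words X `<=` words Y.
Proof. by move=> XY w; apply: sub_all => a; rewrite !inE; exact: XY. Qed.

Lemma words_setT {T} : words [set: T] = [set: seq T].
Proof.
apply/seteqP; split=> // w _.
by elim: w => //= a w IH; rewrite /words /= in_setT.
Qed.

Lemma words_bigcup {I T} {D : set I} {X : I -> set T} :
  D !=set0 ->
  (forall i j, D i -> D j -> exists k, [/\ D k, X i `<=` X k & X j `<=` X k]) ->
  words (\bigcup_(i in D) X i) `<=` \bigcup_(i in D) words (X i).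
Proof.
move=> [i0 Di0] Ddir; elim=> [_|a w IH]; first by exists i0.
rewrite /words /= => /andP[]; rewrite inE => -[i Di Xia] /IH[j Dj Xjw].
have [k [Dk ik jk]] := Ddir i j Di Dj; exists k => //=.
by apply/andP; split; [rewrite inE; exact: ik|exact: words_subset jk _ Xjw].
Qed.

(** A word over [X `|` Z] is determined by two words over [X]: its shadow, in
    which the letters outside [X] are replaced by their images under [h], and
    the word of tags recording which letters were replaced.  Coding both by [g],
    and then the pair of codes by [g] again, gives one element of [X]. *)
Lemma words_double {T} {X Z : set T} {g : seq T -> T} {h : T -> T} :
  set_fun (words X) X g -> set_inj (words X) g ->
  set_fun Z X h -> set_inj Z h ->
  exists2 g' : seq T -> T,
    set_fun (words (X `|` Z)) X g' & set_inj (words (X `|` Z)) g'.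
Proof.
move=> gX g_inj hX h_inj.
have gI u v : words X u -> words X v -> g u = g v -> u = v.
  by move=> Xu Xv; apply: g_inj; rewrite inE.
have words2 a b : X a -> X b -> words X [:: a; b].
  by move=> Xa Xb; rewrite /words /= andbT; apply/andP; split; rewrite inE.
(* The tags: two distinct elements of [X] that the coding itself provides. *)
pose p := g [::]; pose q := g [:: p].
have Xp : X p by exact: gX.
have p1 : words X [:: p] by rewrite /words /= andbT inE.
have Xq : X q by exact: gX.
have pq : p <> q by move=> /gI-/(_ isT p1).
pose shadow z := if z \in X then z else h z.
pose tag z := if z \in X then p else q.
have shX w : words (X `|` Z) w -> words X (map shadow w).
  rewrite /words /= all_map; apply: sub_all => z /=.
  rewrite !inE /shadow; case: ifPn; first by rewrite inE.
  by rewrite notin_setE => nXz [|/hX].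
have tgX w : words X (map tag w).
  rewrite /words /= all_map; elim: w => //= z w ->.
  by rewrite andbT inE /tag; case: ifP.
exists (fun w => g [:: g (map shadow w); g (map tag w)]).
  by move=> w wXZ; apply/gX/words2; apply: gX; [exact: shX|exact: tgX].
move=> u v; rewrite !inE => uXZ vXZ guv.
have [gsh gtg] := gI _ _ (words2 _ _ (gX _ (shX _ uXZ)) (gX _ (tgX u)))
  (words2 _ _ (gX _ (shX _ vXZ)) (gX _ (tgX v))) guv.
move: (gI _ _ (shX _ uXZ) (shX _ vXZ) gsh) (gI _ _ (tgX u) (tgX v) gtg).
elim: u v uXZ vXZ {guv gsh gtg} => [|a u IH] [|b v] //=.
rewrite /words /= => /andP[+ uXZ] /andP[+ vXZ] [shab shuv] [tgab tguv].
rewrite !inE => aXZ bXZ; rewrite (IH v) //; congr cons.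
move: shab tgab; rewrite /shadow /tag.
case: ifPn => aX; case: ifPn => bX // hab; first by move=> /esym.
move: aX bX; rewrite !notin_setE => aX bX _; apply: h_inj => //; rewrite inE.
  by case: aXZ.
by case: bXZ.
Qed.

(** The alphabet of a coding, read off its graph as the one-letter words that
    have a code.  Recovering it from the graph lets plain inclusion of graphs
    serve as the order for Zorn's lemma. *)
Definition letters {T} (G : set (seq T * T)) : set T :=
  [set a | (fst @` G) [:: a]].

(** The graphs of the injections from the words over some set [X] to [X]
    ([coding_graph], [coding_fun]), and the empty graph.  The last clause is
    conditional in order to admit the latter, in which the empty word has no
    code: it is the union of the empty chain. *)
Definition coding {T} (G : set (seq T * T)) : Prop :=
  [/\ set_inj G fst, set_inj G snd,
      G `<=` words (letters G) `*` letters G &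
      letters G !=set0 -> words (letters G) `<=` fst @` G].

Lemma letters_subset {T} {G H : set (seq T * T)} :
  G `<=` H -> letters G `<=` letters H.
Proof. by move=> GH a [p /GH Hp pa]; exists p. Qed.

(** Only the last clause needs an argument: a word over the union of a chain of
    alphabets has finitely many letters, so it is a word over one of them. *)
Lemma coding_bigcup {T} {C : set (set (seq T * T))} :
  C `<=` coding -> total_on C subset -> coding (\bigcup_(G in C) G).
Proof.
move=> Ccod Ctot.
have lettersC : letters (\bigcup_(G in C) G) = \bigcup_(G in C) letters G.
  apply/seteqP; split=> [a [p [G CG Gp] pa]|a [G CG [p Gp pa]]].
    by exists G => //; exists p.
  by exists p => //; exists G.
split.
- by apply: (chain_bigcup_inj Ctot) => G /Ccod[].
- by apply: (chain_bigcup_inj Ctot) => G /Ccod[].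
- move=> p [G CG Gp]; have [_ _ /(_ p Gp)[wp lp] _] := Ccod G CG.
  have GC := letters_subset (bigcup_sup CG : G `<=` \bigcup_(G in C) G).
  by split; [exact: words_subset GC _ wp|exact: GC].
- rewrite lettersC => -[a [G CG Ga]] w Cw.
  (* Adding [a] to [w] forces the alphabet found below to be nonempty. *)
  have Caw : words (\bigcup_(G in C) letters G) (a :: w).
    by apply/andP; split=> //; rewrite inE; exists G.
  have [||H CH] := words_bigcup _ _ _ Caw; first by exists G.
    move=> G1 G2 CG1 CG2; have [G12|G21] := Ctot _ _ CG1 CG2.
      by exists G2; split=> //; exact: letters_subset.
    by exists G1; split=> //; exact: letters_subset.
  move=> /andP[]; rewrite inE => Ha Hw; have [_ _ _] := Ccod H CH.
  by move=> /(_ (ex_intro _ a Ha) w Hw)[p Hp <-]; exists p => //; exists H.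
Qed.

Lemma coding_graph {T} {X : set T} {g : seq T -> T} :
  set_fun (words X) X g -> set_inj (words X) g ->
  let G := [set p | words X p.1 /\ p.2 = g p.1] in
  letters G = X /\ coding G.
Proof.
move=> gX g_inj G.
have GX : letters G = X.
  apply/seteqP; split=> [a [p [+ _] pa]|a Xa].
    by rewrite pa /words /= andbT inE.
  by exists ([:: a], g [:: a]); split=> //; rewrite /words /= andbT inE.
split=> //; split; rewrite ?GX.
- by move=> [u a] [v b]; rewrite !inE => -[/= _ ->] [/= _ ->] ->.
- move=> [u a] [v b]; rewrite !inE => -[/= Xu ->] [/= Xv ->] uv.
  by rewrite (g_inj u v) ?inE.
- by move=> [u a] [/= Xu ->]; split=> //; exact: gX.
- by move=> _ w Xw; exists (w, g w).
Qed.

Lemma coding_fun {T} {G : set (seq T * T)} : coding G -> letters G !=set0 ->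
  exists2 g : seq T -> T, set_fun (words (letters G)) (letters G) g &
    G = [set p | words (letters G) p.1 /\ p.2 = g p.1] /\
    set_inj (words (letters G)) g.
Proof.
move=> [G1 G2 GX wG] [a0 Xa0]; have {}wG := wG (ex_intro _ a0 Xa0).
have /choice[g gP] : forall w, exists a, words (letters G) w -> G (w, a).
  move=> w; have [/wG[[u a] Gua /= <-]|nw] := pselect (words (letters G) w).
    by exists a.
  by exists a0.
exists g => [w /gP/GX[]//|]; split.
  apply/seteqP; split=> [[w a] Gwa|[w a] [/gP Gwg /= ->]//].
  have [/= ww _] := GX _ Gwa; split=> //=.
  have := G1 (w, a) (w, g w); rewrite !inE => /(_ Gwa (gP _ ww) erefl).
  by move=> [].
move=> u v; rewrite !inE => /gP Gu /gP Gv guv.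
by have := G2 (u, g u) (v, g v); rewrite !inE => /(_ Gu Gv guv)[].
Qed.

(** A coding of words over a countably infinite subset of [T], copied from a
    coding of sequences of natural numbers: it shows that the empty graph is
    not maximal. *)
Lemma nat_words_coding {T} : [set: nat] #<= [set: T] ->
  exists X : set T, X !=set0 /\
    exists2 g : seq T -> T, set_fun (words X) X g & set_inj (words X) g.
Proof.
move=> Tinf; have /infiniteP/infinite_setN0[t0 _] := Tinf.
have [i _ i_inj] := card_le_set_inj t0 Tinf.
have /choice[j jP] : forall a, exists n, range i a -> i n = a.
  by move=> a; have [[n _ <-]|] := pselect (range i a); [exists n|exists 0%N].
exists (range i); split; first by exists (i 0%N), 0%N.
exists (fun w => i (choice.pickle (map j w))) => [w _|u v].
  by exists (choice.pickle (map j w)).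
rewrite !inE => Xu Xv /i_inj.
rewrite !inE => /(_ Logic.I Logic.I)/(pcan_inj choice.pickleK).
elim: u v Xu Xv => [|a u IH] [|b v] //= /andP[+ Xu] /andP[+ Xv] [jab juv].
by rewrite !inE => /jP <- /jP <-; rewrite jab (IH v).
Qed.

(** Put a copy [k @` X] of the alphabet [X] outside of it.  The words over the
    union inject into [X] by [words_double]; sending those that are not words
    over [X] into the copy keeps their codes apart from the existing ones. *)
Lemma coding_extend {T} {G : set (seq T * T)} :
  coding G -> letters G !=set0 -> letters G #<= ~` letters G ->
  exists2 H, G `<` H & coding H.
Proof.
move=> Gcod [a0 Xa0].
have [g gX [Gg g_inj]] := coding_fun Gcod (ex_intro _ a0 Xa0).
set X := letters G in Xa0 gX Gg g_inj *.
move=> /(card_le_set_inj a0)[k kX k_inj].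
have /choice[h hP] : forall z, exists x, (k @` X) z -> X x /\ k x = z.
  move=> z; have [[x Xx <-]|nz] := pselect ((k @` X) z); last by exists a0.
  by exists x.
have [||g' g'X g'_inj] := words_double (Z := k @` X) gX g_inj (h := h).
- by move=> z /hP[].
- by move=> y z; rewrite !inE => /hP[_ ky] /hP[_ kz] yz; rewrite -ky yz.
pose f w := if w \in words X then g w else k (g' w).
have [fX f_inj] : set_fun (words (X `|` k @` X)) (X `|` k @` X) f /\
    set_inj (words (X `|` k @` X)) f.
  split=> [w wX|u v].
    rewrite /f; case: ifPn => [|_]; rewrite ?inE; first by move=> /gX; left.
    by right; exists (g' w) => //; exact: g'X.
  rewrite !inE /f => uX vX; case: ifPn => Xu; case: ifPn => Xv.
  - exact: g_inj.
  - rewrite inE in Xu => e; case: (kX _ (g'X _ vX)); rewrite -e; exact: gX.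
  - rewrite inE in Xv => e; case: (kX _ (g'X _ uX)); rewrite e; exact: gX.
  - move=> /k_inj; rewrite !inE => /(_ (g'X _ uX) (g'X _ vX)).
    by apply: g'_inj; rewrite inE.
have [HX Hcod] := coding_graph fX f_inj.
exists [set p | words (X `|` k @` X) p.1 /\ p.2 = f p.1] => //.
split=> [|/letters_subset].
  rewrite Gg => -[w a] [/= Xw ->]; split=> /=.
    by apply: words_subset Xw; exact: subsetUl.
  by rewrite /f mem_set.
rewrite HX => /(_ (k a0)) Xk; case: (kX _ Xa0); apply: Xk.
by right; exists a0.
Qed.

Theorem card_seq_le T : [set: nat] #<= [set: T] -> [set: seq T] #<= [set: T].
Proof.
move=> Tinf.
have [G [Gcod Gmax]] := Zorn_bigcup (@coding_bigcup T).
have [G0|nG0] := pselect (letters G !=set0); last first.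
  have [X [[a Xa] [g gX g_inj]]] := nat_words_coding Tinf.
  have [HX Hcod] := coding_graph gX g_inj; case: (Gmax _ _ Hcod).
  have [_ _ GX _] := Gcod.
  split=> [p /GX[_ lp]|/letters_subset]; first by case: nG0; exists p.2.
  by rewrite HX => /(_ a Xa) Ga; apply: nG0; exists a.
have [XX|nXX] := card_le_total (letters G) (~` letters G).
  by have [H GH Hcod] := coding_extend Gcod G0 XX; case: (Gmax H GH Hcod).
have [a0 _] := G0; have [g gX [_ g_inj]] := coding_fun Gcod G0.
have [h hX h_inj] := card_le_set_inj a0 nXX.
have [f _] := words_double gX g_inj hX h_inj; rewrite setUv words_setT.
exact: set_inj_card_le.
Qed.

Lemma card_seq_mono {S T} (t0 : T) :
  [set: S] #<= [set: T] -> [set: seq S] #<= [set: seq T].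
Proof.
move=> /(card_le_set_inj t0)[f _ f_inj].
apply: (@set_inj_card_le _ _ _ _ (map f)) => //.
have {}f_inj : injective f by move=> x y; apply: f_inj; rewrite inE.
by move=> u v _ _; exact: inj_map.
Qed.

(** The largest of [nat], [A] and [B] is an infinite set [C] smaller than [K].
    The length of a word over [C] can tell letters of [A] from letters of [B],
    so the words over [A + B] inject into words of words over [C], and thence
    into [C]. *)
Lemma card_lt_words {T U V} {A : set T} {B : set U} {K : set V} :
  ~ countable K -> ~ (K #<= A) -> ~ (K #<= B) ->
  ~ (K #<= [set: seq (A + B)]).
Proof.
move=> Kunc KA KB.
have bound (M : Type) (C : set M) : [set: nat] #<= C -> A #<= C -> B #<= C ->
    ~ (K #<= C) -> ~ (K #<= [set: seq (A + B)]).
  move=> natC AC BC; apply: contra_not => Kw.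
  have /card_eqPle[CT TC] := card_setT C.
  apply: card_le_trans Kw (card_le_trans _ CT).
  have natCT := card_le_trans natC TC.
  have /infiniteP/infinite_setN0[c0 _] := natCT.
  have CC := card_seq_le _ natCT.
  apply: card_le_trans (CC); apply: card_le_trans (card_seq_mono c0 (CC)).
  apply: card_seq_mono => //; first exact: [::].
  have /card_leP[f] := AC; have /card_leP[g] := BC.
  pose e (z : A + B) : seq C :=
    match z with inl a => [:: f a] | inr b => [:: g b; g b] end.
  apply: (@set_inj_card_le _ _ _ _ e) => // -[a|b] [a'|b'] _ _ //= [].
    by move=> /('inj_f (mem_set Logic.I) (mem_set Logic.I)) ->.
  by move=> /('inj_g (mem_set Logic.I) (mem_set Logic.I)) ->.
have [AB|BA] := card_le_total A B.
  have [nB|Bn] := card_le_total [set: nat] B; first exact: (bound _ B).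
  by apply: (bound _ [set: nat]) => //; exact: card_le_trans AB Bn.
have [nA|An] := card_le_total [set: nat] A; first exact: (bound _ A).
by apply: (bound _ [set: nat]) => //; exact: card_le_trans BA An.
Qed.

(** * Closing a set under finitary operations *)

Definition op_closure {B} (F : set (finitary_op B)) (S : set B) : set B :=
  smallest (closed_under F) S.

Lemma op_closure_closed {B} (F : set (finitary_op B)) (S : set B) :
  closed_under F (op_closure F S).
Proof.
move=> f Ff t tS M /= MS; have [Mcl _] := MS.
by apply: Mcl Ff _ _ => i; exact: tS.
Qed.

(** This is where finitariness of the operations matters: the finitely many
    arguments already lie in one member of the union. *)
Lemma closed_under_bigcup {B I} {F : set (finitary_op B)} {D : set I}
    {X : I -> set B} :
  D !=set0 ->
  (forall i j, D i -> D j -> exists k, [/\ D k, X i `<=` X k & X j `<=` X k]) ->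
  (forall i, closed_under F (X i)) ->
  closed_under F (\bigcup_(i in D) X i).
Proof.
move=> D0 Ddir Xcl f Ff t tX.
have /words_bigcup -/(_ D0 Ddir)[i Di tXi] : words (\bigcup_(i in D) X i) t.
  by apply/all_tnthP => i; rewrite inE; exact: tX.
exists i => //; apply: Xcl => // j; move/all_tnthP: tXi => /(_ j).
by rewrite inE.
Qed.

(** Words over [S + F] are programs in reverse Polish notation for a stack
    machine: a generator is pushed, an operation replaces its arguments on top
    of the stack by its value and does nothing when they are too few. *)
Definition exec {B} {F : set (finitary_op B)} {S : set B} (stack : seq B)
    (c : S + F) : seq B :=
  match c with
  | inl s => val s :: stack
  | inr f => let: existT n op := val f in
      if insub (take n stack) is Some t then op t :: drop n stack else stack
  end.

Definition evaluates {B} {F : set (finitary_op B)} {S : set B}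
    (w : seq (S + F)) (y : B) : Prop :=
  forall stack, foldl exec stack w = y :: stack.

Lemma op_closure_evaluates {B} (F : set (finitary_op B)) (S : set B) :
  op_closure F S `<=` [set y | exists w : seq (S + F), evaluates w y].
Proof.
apply: smallest_sub; last first.
  by move=> s Ss; exists [:: inl (exist _ s (mem_set Ss))].
move=> [n op] Ff t /= tE.
have [w wt] : exists w : seq (S + F), forall stack,
    foldl exec stack w = t ++ stack.
  have : all (mem [set y | exists w : seq (S + F), evaluates w y]) t.
    by apply/all_tnthP => i; rewrite inE.
  (* The code of the tail runs first, so that the head ends up on top. *)
  elim: (tval t) => [|y l IH] /=; first by exists [::].
  move=> /andP[/set_mem[u uy] /IH[v vl]].
  by exists (v ++ u) => stack; rewrite foldl_cat vl uy.
exists (rcons w (inr (exist (fun f => f \in F) _ (mem_set Ff)))) => stack.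
rewrite foldl_rcons wt /= take_size_cat ?size_tuple //.
by rewrite drop_size_cat ?size_tuple // valK.
Qed.

Lemma card_op_closure_le {B} (F : set (finitary_op B)) (S : set B) :
  op_closure F S #<= [set: seq (S + F)].
Proof.
have [->|/set0P[y0 _]] := eqVneq (op_closure F S) set0; first exact: card_ge0.
have CE : op_closure F S `<=`
    (fun w : seq (S + F) => head y0 (foldl exec [::] w)) @` setT.
  move=> y Sy; have [w wy] := op_closure_evaluates F S y Sy.
  by exists w => //; rewrite wy.
exact: card_le_trans (subset_card_le CE) (card_image_le _ _).
Qed.

(** * The pathway *)

(** With a greatest element [m], all of [kappa] would inject into words of
    length at most one over the initial segment below [m], which is too small
    a set. *)
Lemma cardinal_no_max {d} {kappa : orderType d} :
  is_cardinal kappa -> ~ countable [set: kappa] ->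
  forall m : kappa, exists n : kappa, (m < n)%O.
Proof.
move=> [_ seg] unc m; apply: contrapT => /forallNP mmax.
have K0 : ~ ([set: kappa] #<= @set0 nat).
  by rewrite card_le0 => /eqP/seteqP[/(_ m)/(_ Logic.I)].
apply: (card_lt_words unc (proj2 (seg m)) K0).
pose e xi : seq ([set xi | (xi < m)%O] + @set0 nat) :=
  if pselect (xi < m)%O is left h then [:: inl (exist _ xi (mem_set h))]
  else [::].
apply: (@set_inj_card_le _ _ _ _ e) => // xi eta _ _; rewrite /e.
case: pselect => [xim|]; case: pselect => [etam|] //; first by case.
have top zeta : ~ (zeta < m)%O -> zeta = m.
  by move=> /negP; rewrite -leNgt le_eqVlt => /orP[/eqP//|/mmax].
by move=> /top-> /top->.
Qed.

Theorem theorem3p3 (x : cardchar) (d : Order.disp_t) (kappa : orderType d)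
    (kappa_cardinal : is_cardinal kappa)
    (kappa_uncountable : ~ countable [set: kappa])
    (kappa_value : value_is x [set: kappa])
    (kappa_card_B : [set: responses x] #= [set: kappa])
    (F : set (finitary_op (responses x)))
    (F_small : card_lt F [set: kappa]) :
  exists P : kappa -> set (responses x), is_pathway F P.
Proof.
have /infinite_setN0[k0 _] : infinite_set [set: kappa].
  by move=> /finite_set_countable.
have /card_eqPle[/(card_le_set_inj k0)[f _ f_inj] _] := kappa_card_B.
pose S (alpha : kappa) := [set y | (f y < alpha)%O].
pose P alpha := op_closure F (S alpha).
have P_incr (alpha beta : kappa) : (alpha <= beta)%O -> P alpha `<=` P beta.
  move=> ab; apply: sub_smallest2r; first exact: op_closure_closed.
  by move=> y /= /lt_le_trans; exact.
have P_small alpha : ~ ([set: kappa] #<= P alpha).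
  move=> kP; have /card_lt_words : ~ ([set: kappa] #<= S alpha).
    have SA : S alpha #<= [set xi : kappa | (xi < alpha)%O].
      apply: (@set_inj_card_le _ _ _ _ f) => // y z _ _.
      by apply: f_inj; rewrite inE.
    have [_ kappaA] := proj2 kappa_cardinal alpha.
    by move=> kS; exact: kappaA (card_le_trans kS SA).
  move=> /(_ _ F kappa_uncountable (proj2 F_small)); apply.
  exact: card_le_trans kP (card_op_closure_le _ _).
exists P; split.
- exact: P_incr.
- move=> alpha [alpha0 alphalim]; apply/seteqP; split; last first.
    by move=> y [xi xia]; apply: P_incr; exact: ltW.
  apply: smallest_sub.
    apply: closed_under_bigcup; [by []| |by move=> ?; exact: op_closure_closed].
    move=> xi eta xia etaa; exists (Order.max xi eta); split.
    + by rewrite /= gt_max xia.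
    + by apply: P_incr; rewrite le_max lexx.
    + by apply: P_incr; rewrite le_max lexx orbT.
  move=> y /alphalim[eta yeta etaa]; exists eta => //.
  exact: sub_gen_smallest.
- apply/seteqP; split=> // y _.
  have [n yn] := cardinal_no_max kappa_cardinal kappa_uncountable (f y).
  by exists n => //; exact: sub_gen_smallest.
- move=> alpha; apply: contrapT => /forallNP noa.
  apply: (P_small alpha); apply: (proj2 kappa_value) => a.
  have /existsNP[y /not_implyP[Py /contrapT ay]] := noa a.
  by exists y.
- move=> alpha; exact: op_closure_closed.
Qed.
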